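(* Let $r,L_y,L_z,\bar P>0$, $\xi\in(0,1]$, $\theta=\frac{\pi}{2}$ and $\phi\in(-\frac{\pi}{2},\frac{\pi}{2})$, and let $\gamma$ be the closed-form SNR of the context. Consider in $\mathbb R^3$ the points $O=(r\cos\phi,\,r\sin\phi,\,0)$ (user location), $O'=(0,r\sin\phi,0)$ (the projection of $O$ onto the $y$-axis), and the four corners of the upper half of the array $D_1=(0,\frac{L_y}{2},\frac{L_z}{2})$, $D_2=(0,\frac{L_y}{2},0)$, $D_3=(0,-\frac{L_y}{2},0)$, $D_4=(0,-\frac{L_y}{2},\frac{L_z}{2})$. Define the angles $\eta_1=\angle D_2OO'$, $\eta_2=\angle D_3OO'$ (horizontal angular spans) and $\beta_1=\angle D_1OD_2$, $\beta_2=\angle D_3OD_4$ (vertical angular spans). Then $$\gamma=\frac{\xi\bar P}{2\pi}\left[(-1)^i\arctan(\tan\eta_1\sin\beta_1)+(-1)^j\arctan(\tan\eta_2\sin\beta_2)\right],$$ where $(i,j)=(0,1)$ if $r\sin\phi<-\frac{L_y}{2}$, $(i,j)=(0,0)$ if $-\frac{L_y}{2}\le r\sin\phi\le\frac{L_y}{2}$, and $(i,j)=(1,0)$ if $r\sin\phi>\frac{L_y}{2}$.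
   Context: For a planar array of physical dimensions $L_y\times L_z$ in the $y$-$z$ plane centred at the origin, with array occupation ratio $\xi$ and transmit SNR $\bar P$, and a user at distance $r$ with zenith angle $\theta\in(0,\pi)$ and azimuth angle $\phi\in(-\frac{\pi}{2},\frac{\pi}{2})$, i.e. located at $(r\Psi,r\Phi,r\Omega)$ with $\Psi=\sin\theta\cos\phi$, $\Phi=\sin\theta\sin\phi$, $\Omega=\cos\theta$, the closed-form SNR is $$\gamma=\frac{\xi\bar P}{4\pi}\left[U\!\left(\tfrac{L_y}{2r}-\Phi,\tfrac{L_z}{2r}-\Omega\right)+U\!\left(\tfrac{L_y}{2r}+\Phi,\tfrac{L_z}{2r}-\Omega\right)+U\!\left(\tfrac{L_y}{2r}-\Phi,\tfrac{L_z}{2r}+\Omega\right)+U\!\left(\tfrac{L_y}{2r}+\Phi,\tfrac{L_z}{2r}+\Omega\right)\right],$$ with $U(x,y)=\arctan\!\left(\dfrac{xy}{\Psi\sqrt{\Psi^2+x^2+y^2}}\right)$. $\angle XYZ\in[0,\pi]$ denotes the unoriented angle at vertex $Y$. *)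

(* Defs.v *)
From Stdlib Require Export Reals.
Local Open Scope R_scope.

(* [theta] is the zenith angle and [phi] the azimuth angle, so that the user
   at distance [r] is at (r * Psi theta phi, r * Phi theta phi, r * Omega theta). *)
Definition Psi (theta phi : R) : R := sin theta * cos phi.
Definition Phi (theta phi : R) : R := sin theta * sin phi.
Definition Omega (theta : R) : R := cos theta.

(* [psi] is to be taken as [Psi theta phi] for the direction of the user. *)
Definition U (psi x y : R) : R :=
  atan (x * y / (psi * sqrt (psi ^ 2 + x ^ 2 + y ^ 2))).

(* [xi] is the array occupation ratio and [P] the transmit SNR. *)
Definition snr (xi P Ly Lz r theta phi : R) : R :=
  let psi := Psi theta phi in
  let f := Phi theta phi in
  let w := Omega theta in
  xi * P / (4 * PI) *
    (U psi (Ly / (2 * r) - f) (Lz / (2 * r) - w)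
     + U psi (Ly / (2 * r) + f) (Lz / (2 * r) - w)
     + U psi (Ly / (2 * r) - f) (Lz / (2 * r) + w)
     + U psi (Ly / (2 * r) + f) (Lz / (2 * r) + w)).

Record point3 : Type := Point3 { px : R; py : R; pz : R }.

Definition sub3 (A B : point3) : point3 :=
  Point3 (px A - px B) (py A - py B) (pz A - pz B).

Definition dot3 (u v : point3) : R :=
  px u * px v + py u * py v + pz u * pz v.

Definition norm3 (u : point3) : R := sqrt (dot3 u u).

(* Unoriented angle XYZ in [0, PI] at the vertex [Y]; it is meaningful only
   when [X] and [Z] both differ from [Y]. *)
Definition angle (X Y Z : point3) : R :=
  let u := sub3 X Y in
  let v := sub3 Z Y in
  acos (dot3 u v / (norm3 u * norm3 v)).

(* Main.v *)
(* Put a = r cos phi, z = Lz / 2 and let d be the signed offset along the y-axis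
   from the user to a corner of the array.  Right triangles give tan eta = |d| / a
   and sin beta = z / sqrt (a^2 + d^2 + z^2), so atan (tan eta * sin beta) is the
   value of [U] at the corner up to the sign of d, as [U] is odd in its first
   argument; the signs (-1)^i and (-1)^j restore it.  At theta = PI / 2 we have
   Omega = 0, so the four terms of the SNR are pairwise equal. *)
Require Import Defs.
From Stdlib Require Import Reals Lra.
Local Open Scope R_scope.

Lemma hypot_pos (h d : R) : 0 < h -> 0 < h ^ 2 + d ^ 2.
Proof. intros; nra. Qed.

(** Pythagoras for the legs [h] and [Rabs d]: both sides are nonnegative with equal squares. The
    left side has the shape produced by [sin_acos]. *)
Lemma sqrt_one_minus_cos_sq (h d : R) : 0 < h ->
  sqrt (1 - (h / sqrt (h ^ 2 + d ^ 2))²) = Rabs d / sqrt (h ^ 2 + d ^ 2).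
Proof.
  intros Hh.
  pose proof (hypot_pos h d Hh) as Hp.
  pose proof (sqrt_lt_R0 _ Hp) as Hs.
  rewrite <- (sqrt_Rsqr (Rabs d / sqrt (h ^ 2 + d ^ 2))).
  - f_equal.
    rewrite !Rsqr_div', <- Rsqr_abs, Rsqr_sqrt by lra.
    unfold Rsqr; field; lra.
  - apply Rmult_le_pos; [apply Rabs_pos | left; now apply Rinv_0_lt_compat].
Qed.

Lemma cos_right_triangle_bound (h d : R) : 0 < h ->
  -1 <= h / sqrt (h ^ 2 + d ^ 2) <= 1.
Proof.
  intros Hh.
  pose proof (hypot_pos h d Hh) as Hp.
  pose proof (sqrt_lt_R0 _ Hp) as Hs.
  assert (Hle : h <= sqrt (h ^ 2 + d ^ 2)).
  { rewrite <- (sqrt_pow2 h) at 1 by lra. apply sqrt_le_1; nra. }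
  split.
  - apply Rle_trans with 0; [lra | left; now apply Rdiv_lt_0_compat].
  - apply (Rmult_le_reg_r (sqrt (h ^ 2 + d ^ 2))); [exact Hs |].
    unfold Rdiv. rewrite Rmult_assoc, Rinv_l; lra.
Qed.

Lemma sin_acos_right_triangle (h d : R) : 0 < h ->
  sin (acos (h / sqrt (h ^ 2 + d ^ 2))) = Rabs d / sqrt (h ^ 2 + d ^ 2).
Proof.
  intros Hh.
  rewrite sin_acos by now apply cos_right_triangle_bound.
  now apply sqrt_one_minus_cos_sq.
Qed.

Lemma tan_acos_right_triangle (h d : R) : 0 < h ->
  tan (acos (h / sqrt (h ^ 2 + d ^ 2))) = Rabs d / h.
Proof.
  intros Hh.
  pose proof (sqrt_lt_R0 _ (hypot_pos h d Hh)) as Hs.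
  unfold tan.
  rewrite sin_acos_right_triangle, cos_acos
    by (try apply cos_right_triangle_bound; assumption).
  field; lra.
Qed.

Lemma angle_sym (X Y Z : point3) : angle X Y Z = angle Z Y X.
Proof.
  unfold angle, dot3; cbv zeta; do 2 f_equal; ring.
Qed.

(** The triangle has its right angle at the projection of the user, with adjacent leg [a] and
    opposite leg [Rabs (y - b)]. *)
Lemma tan_horizontal_angle (a b y : R) : 0 < a ->
  tan (angle (Point3 0 y 0) (Point3 a b 0) (Point3 0 b 0)) = Rabs (y - b) / a.
Proof.
  intros Ha.
  rewrite <- tan_acos_right_triangle by exact Ha.
  unfold angle, norm3, dot3, sub3; simpl px; simpl py; simpl pz; cbv zeta.
  pose proof (sqrt_lt_R0 _ (hypot_pos a (y - b) Ha)) as Hs.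
  replace ((0 - a) * (0 - a) + (b - b) * (b - b) + (0 - 0) * (0 - 0))
    with (a ^ 2) by ring.
  rewrite sqrt_pow2 by lra.
  replace ((0 - a) * (0 - a) + (y - b) * (y - b) + (0 - 0) * (0 - 0))
    with (a ^ 2 + (y - b) ^ 2) by ring.
  do 2 f_equal. field; lra.
Qed.

(** The vertical edge is orthogonal to the plane of height 0 containing the user, so the right angle
    is at the foot of that edge. *)
Lemma sin_vertical_angle (a b y z : R) : 0 < a -> 0 <= z ->
  sin (angle (Point3 0 y z) (Point3 a b 0) (Point3 0 y 0))
  = z / sqrt (a ^ 2 + (y - b) ^ 2 + z ^ 2).
Proof.
  intros Ha Hz.
  pose proof (hypot_pos a (y - b) Ha) as Hp.
  unfold angle, norm3, dot3, sub3; simpl px; simpl py; simpl pz; cbv zeta.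
  (* The distance from the user to the foot is the leg adjacent to the angle; the opposite leg is
     [z]. *)
  set (h := sqrt (a ^ 2 + (y - b) ^ 2)).
  assert (Hh : 0 < h) by now apply sqrt_lt_R0.
  assert (Hh2 : h ^ 2 = a ^ 2 + (y - b) ^ 2) by (apply pow2_sqrt; lra).
  replace ((0 - a) * (0 - a) + (y - b) * (y - b) + (0 - 0) * (0 - 0))
    with (h ^ 2) by (rewrite Hh2; ring).
  replace ((0 - a) * (0 - a) + (y - b) * (y - b) + (z - 0) * (0 - 0))
    with (h ^ 2) by (rewrite Hh2; ring).
  replace ((0 - a) * (0 - a) + (y - b) * (y - b) + (z - 0) * (z - 0))
    with (h ^ 2 + z ^ 2) by (rewrite Hh2; ring).
  rewrite sqrt_pow2, <- Hh2 by lra.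
  pose proof (sqrt_lt_R0 _ (hypot_pos h z Hh)) as Hs.
  replace (h ^ 2 / (sqrt (h ^ 2 + z ^ 2) * h)) with (h / sqrt (h ^ 2 + z ^ 2))
    by (field; lra).
  rewrite sin_acos_right_triangle, Rabs_pos_eq by assumption.
  reflexivity.
Qed.

Lemma U_opp (psi x y : R) : U psi (- x) y = - U psi x y.
Proof.
  unfold U. rewrite <- atan_opp. f_equal.
  replace ((- x) ^ 2) with (x ^ 2) by ring.
  unfold Rdiv; ring.
Qed.

(** Numerator and denominator of the argument both scale by [r ^ 2]. This passes from the normalised
    quantities of [snr] to actual lengths. *)
Lemma U_scale (r psi x y : R) : 0 < r -> 0 < psi ->
  U (r * psi) (r * x) (r * y) = U psi x y.
Proof.
  intros Hr Hpsi. unfold U. f_equal.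
  assert (Hs : 0 < sqrt (psi ^ 2 + x ^ 2 + y ^ 2)).
  { apply sqrt_lt_R0. pose proof (hypot_pos psi x Hpsi). pose proof (pow2_ge_0 y). lra. }
  replace ((r * psi) ^ 2 + (r * x) ^ 2 + (r * y) ^ 2)
    with (r ^ 2 * (psi ^ 2 + x ^ 2 + y ^ 2)) by ring.
  rewrite sqrt_mult_alt, sqrt_pow2 by nra.
  field; lra.
Qed.

Lemma atan_tan_sin_angles (a b y z : R) : 0 < a -> 0 <= z ->
  atan (tan (angle (Point3 0 y 0) (Point3 a b 0) (Point3 0 b 0))
        * sin (angle (Point3 0 y z) (Point3 a b 0) (Point3 0 y 0)))
  = U a (Rabs (y - b)) z.
Proof.
  intros Ha Hz.
  rewrite tan_horizontal_angle, sin_vertical_angle by assumption.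
  unfold U. rewrite pow2_abs. f_equal.
  assert (0 < sqrt (a ^ 2 + (y - b) ^ 2 + z ^ 2)).
  { apply sqrt_lt_R0. pose proof (hypot_pos a (y - b) Ha). pose proof (pow2_ge_0 z). lra. }
  field; lra.
Qed.

Theorem lemma1 (r Ly Lz P xi theta phi : R)
  (hr : 0 < r) (hLy : 0 < Ly) (hLz : 0 < Lz) (hP : 0 < P)
  (hxi : 0 < xi <= 1)
  (htheta : theta = PI / 2)
  (hphi : - (PI / 2) < phi < PI / 2)
  (i j : nat)
  (hleft : r * sin phi < - (Ly / 2) -> i = 0%nat /\ j = 1%nat)
  (hmid : - (Ly / 2) <= r * sin phi <= Ly / 2 -> i = 0%nat /\ j = 0%nat)
  (hright : r * sin phi > Ly / 2 -> i = 1%nat /\ j = 0%nat) :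
  let O := Point3 (r * cos phi) (r * sin phi) 0 in
  let O' := Point3 0 (r * sin phi) 0 in
  let D1 := Point3 0 (Ly / 2) (Lz / 2) in
  let D2 := Point3 0 (Ly / 2) 0 in
  let D3 := Point3 0 (- (Ly / 2)) 0 in
  let D4 := Point3 0 (- (Ly / 2)) (Lz / 2) in
  let eta1 := angle D2 O O' in
  let eta2 := angle D3 O O' in
  let beta1 := angle D1 O D2 in
  let beta2 := angle D3 O D4 in
  snr xi P Ly Lz r theta phi =
    xi * P / (2 * PI) *
      ((-1) ^ i * atan (tan eta1 * sin beta1)
       + (-1) ^ j * atan (tan eta2 * sin beta2)).
Proof.
  cbv zeta.
  assert (Hc : 0 < cos phi) by (apply cos_gt_0; lra).
  assert (Ha : 0 < r * cos phi) by (apply Rmult_lt_0_compat; lra).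
  (* [beta2] names its corner last, [beta1] first; both are brought to the latter order. *)
  rewrite (angle_sym (Point3 0 (- (Ly / 2)) 0) _ (Point3 0 (- (Ly / 2)) (Lz / 2))).
  rewrite !atan_tan_sin_angles by lra.
  unfold snr, Psi, Phi, Omega; cbv zeta.
  rewrite htheta, sin_PI2, cos_PI2, !Rmult_1_l, Rminus_0_r, Rplus_0_r.
  rewrite <- (U_scale r (cos phi) (Ly / (2 * r) - sin phi)) by assumption.
  rewrite <- (U_scale r (cos phi) (Ly / (2 * r) + sin phi)) by assumption.
  replace (r * (Ly / (2 * r) - sin phi)) with (Ly / 2 - r * sin phi) by (field; lra).
  (* The inner expression is the signed offset from the user to [D3], as in the angle [eta2]. *)
  replace (r * (Ly / (2 * r) + sin phi)) with (- (- (Ly / 2) - r * sin phi))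
    by (field; lra).
  replace (r * (Lz / (2 * r))) with (Lz / 2) by (field; lra).
  pose proof PI_RGT_0 as Hpi.
  (* The three ranges fix the signs of the offsets to [D2] and [D3]: both positive, then nonnegative
     and nonpositive, then both negative. *)
  destruct (Rlt_le_dec (r * sin phi) (- (Ly / 2))) as [Hl | Hl];
    [| destruct (Rle_lt_dec (r * sin phi) (Ly / 2)) as [Hr | Hr]].
  - destruct (hleft Hl) as [-> ->].
    rewrite !Rabs_pos_eq, U_opp by lra. field; lra.
  - destruct (hmid (conj Hl Hr)) as [-> ->].
    rewrite Rabs_pos_eq, Rabs_left1 by lra. field; lra.
  - destruct (hright Hr) as [-> ->].
    (* Only the [D2] offset needs oddness here: the negated [D3] offset already appears in this form
       on the SNR side. *)
    rewrite !Rabs_left1 by lra. rewrite (U_opp _ (Ly / 2 - r * sin phi)). field; lra.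
Qed.
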